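(* Let $(M,d)$ be a complete pointed metric space and let $\mu$ be a positive Radon measure on $\beta\widetilde{M}$. The following are equivalent: (i) $\mu$ is $\preccurlyeq$-minimal; (ii) for every $f\in C(\beta\widetilde{M})$ that is constant on every fibre of $q$, $\int f\,d\mu=\inf\{\int g\,d\mu: g\in G,\ f\le g\}$; (iii) for every upper semicontinuous $f:\beta\widetilde{M}\to\mathbb{R}$ that is constant on every fibre of $q$, $\int_{\beta\widetilde{M}} f\,d\mu=\inf\{\int g\,d\mu: g\in G,\ f\le g\}$; (iv) for every Borel set $A\subset\widetilde{M}^G$ such that $\mu$ is concentrated on $q^{-1}(A)$ and every upper semicontinuous $f:\beta\widetilde{M}\to\mathbb{R}$ that is constant on every fibre of $q$ included in $q^{-1}(A)$, $\int_{\beta\widetilde{M}} f\,d\mu=\inf\{\int g\,d\mu: g\in G,\ f\le g\}$.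
   Context: $\widetilde{M}=\{(x,y)\in M\times M:x\ne y\}$, $\beta\widetilde{M}$ is its Stone–Čech compactification, and Radon measures on $\beta\widetilde{M}$ are identified with $C(\beta\widetilde{M})^*$; for $x\ne y$ in $M$, $d(x,y)$ is the metric and $g(x,y)$ denotes the value of $g\in C(\beta\widetilde{M})$ at $(x,y)\in\widetilde{M}\subset\beta\widetilde{M}$. $G$ is the set of $g\in C(\beta\widetilde{M})$ such that $d(x,y)g(x,y)\le d(x,u)g(x,u)+d(u,y)g(u,y)$ for all distinct $x,u,y\in M$. For positive Radon measures $\mu,\nu$, $\mu\preccurlyeq\nu$ iff $\int g\,d\mu\le\int g\,d\nu$ for all $g\in G$; $\mu$ is $\preccurlyeq$-minimal if every positive $\nu$ with $\nu\preccurlyeq\mu$ satisfies $\mu\preccurlyeq\nu$. Define the equivalence relation $\zeta\sim\omega$ on $\beta\widetilde{M}$ by $g(\zeta)=g(\omega)$ for all $g\in G$; $\widetilde{M}^G=\beta\widetilde{M}/\!\sim$ with the quotient topology (a compact Hausdorff space) and $q:\beta\widetilde{M}\to\widetilde{M}^G$ the quotient map. Throughout, $M$ has at least three distinct points. *)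

(* Defs.v *)
From HB Require Import structures.
From mathcomp Require Import all_boot all_order all_algebra.
From mathcomp Require Import all_classical all_reals all_analysis.
From mathcomp Require Import Rstruct Rstruct_topology.
From Stdlib Require Import Rdefinitions.
From mathcomp Require Import generic_quotient.

Set Implicit Arguments.
Unset Strict Implicit.
Unset Printing Implicit Defensive.

Import Order.TTheory GRing.Theory Num.Theory.
Local Open Scope classical_set_scope.
Local Open Scope ring_scope.

Notation R := Rdefinitions.R.

Definition is_metric (M : Type) (d : M -> M -> R) : Prop :=
  [/\ (forall x y, 0 <= d x y),
      (forall x y, d x y = 0 <-> x = y),
      (forall x y, d x y = d y x) &
      (forall x y z, d x z <= d x y + d y z)].

Definition metric_complete (M : Type) (d : M -> M -> R) : Prop :=
  forall u : nat -> M,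
    (forall eps : R, 0 < eps -> exists N : nat, forall m n : nat,
        (leq N m) -> (leq N n) -> d (u m) (u n) < eps) ->
    exists l : M, forall eps : R, 0 < eps -> exists N : nat, forall n : nat,
        (leq N n) -> d (u n) l < eps.

Definition Mt (M : Type) := {p : M * M | p.1 <> p.2}.

Definition Mt_continuous (M : Type) (d : M -> M -> R) (T : topologicalType)
    (h : Mt M -> T) : Prop :=
  forall (p : Mt M) (U : set T), nbhs (h p) U ->
    exists2 delta : R, 0 < delta & forall p' : Mt M,
      d (sval p).1 (sval p').1 < delta -> d (sval p).2 (sval p').2 < delta ->
      U (h p').

Definition is_stone_cech (M : Type) (d : M -> M -> R) (K : topologicalType)
    (e : Mt M -> K) : Prop :=
  [/\ compact [set: K], hausdorff_space K, Mt_continuous d e,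
      closure (range e) = [set: K] &
      forall h : Mt M -> R, Mt_continuous d h ->
        (exists c : R, forall p, `|h p| <= c) ->
        exists2 H : K -> R, continuous H & forall p, H (e p) = h p].

Definition inG (M : Type) (d : M -> M -> R) (K : topologicalType)
    (e : Mt M -> K) (g : K -> R) : Prop :=
  continuous g /\
  forall a b c : Mt M,
    (sval a).1 = (sval c).1 -> (sval a).2 = (sval b).1 ->
    (sval b).2 = (sval c).2 ->
    d (sval c).1 (sval c).2 * g (e c)
      <= d (sval a).1 (sval a).2 * g (e a) + d (sval b).1 (sval b).2 * g (e b).

Definition Gsim (M : Type) (d : M -> M -> R) (K : topologicalType)
    (e : Mt M -> K) : rel K :=
  fun z w => `[< forall g, inG d e g -> g z = g w >].

Lemma Gsim_refl (M : Type) (d : M -> M -> R) (K : topologicalType)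
    (e : Mt M -> K) : reflexive (Gsim d e).
Proof. by move=> x; apply/asboolP. Qed.

Lemma Gsim_sym (M : Type) (d : M -> M -> R) (K : topologicalType)
    (e : Mt M -> K) : symmetric (Gsim d e).
Proof.
move=> x y; apply/asboolP/asboolP => H g Gg; by rewrite (H g Gg).
Qed.

Lemma Gsim_trans (M : Type) (d : M -> M -> R) (K : topologicalType)
    (e : Mt M -> K) : transitive (Gsim d e).
Proof.
move=> y x z /asboolP Hxy /asboolP Hyz; apply/asboolP => g Gg.
by rewrite (Hxy g Gg) (Hyz g Gg).
Qed.

Definition Gsim_equiv (M : Type) (d : M -> M -> R) (K : topologicalType)
    (e : Mt M -> K) : equiv_rel K :=
  EquivRel (Gsim d e) (@Gsim_refl M d K e) (@Gsim_sym M d K e) (@Gsim_trans M d K e).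

Definition MtG (M : Type) (d : M -> M -> R) (K : topologicalType)
    (e : Mt M -> K) : topologicalType :=
  quotient_topology {eq_quot Gsim_equiv d e}%qT.

Definition qG (M : Type) (d : M -> M -> R) (K : topologicalType)
    (e : Mt M -> K) : K -> MtG d e :=
  fun z => (\pi_(MtG d e) z)%qT.

Definition borel (T : topologicalType) (A : set T) : Prop := <<s @open T >> A.

Notation BorelK K := (g_sigma_algebraType (@open K)).
Notation measureK K := {measure set (BorelK K) -> \bar R}.

Definition radon (K : ptopologicalType) (mu : measureK K) : Prop :=
  [/\ (mu setT < +oo)%E,
      (forall A : set K, borel A ->
         mu A = ereal_inf [set mu U | U in [set U : set K | open U /\ A `<=` U]]) &
      (forall U : set K, open U ->
         mu U = ereal_sup [set mu C | C in [set C : set K | compact C /\ C `<=` U]])].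

Definition integ (K : ptopologicalType) (mu : measureK K) (f : K -> R) : \bar R :=
  (\int[mu]_(x in [set: BorelK K]) (f x)%:E)%E.

Definition Gle (M : Type) (d : M -> M -> R) (K : ptopologicalType)
    (e : Mt M -> K) (mu nu : measureK K) : Prop :=
  forall g : K -> R, inG d e g -> (integ mu g <= integ nu g)%E.

Definition Gminimal (M : Type) (d : M -> M -> R) (K : ptopologicalType)
    (e : Mt M -> K) (mu : measureK K) : Prop :=
  forall nu : measureK K, radon nu -> Gle d e nu mu -> Gle d e mu nu.

Definition Ginf (M : Type) (d : M -> M -> R) (K : ptopologicalType)
    (e : Mt M -> K) (mu : measureK K) (f : K -> R) : \bar R :=
  ereal_inf [set integ mu g | g in [set g : K -> R | inG d e g /\ forall x, f x <= g x]].

Definition upper_semicontinuous (T : topologicalType) (f : T -> R) : Prop :=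
  forall (x : T) (c : R), f x < c -> \forall y \near x, f y < c.

(* Main.v *)
(** Let [L = G - G], a vector lattice of continuous functions containing the
    constants. An upper semicontinuous function that is constant on the fibres of
    [q] is, by compactness and outer regularity, approximated from above in
    [mu]-mean by elements of [L].

    If [mu] is minimal and [f] is continuous and constant on the fibres, apply
    Hahn-Banach to the sublinear functional [p f = inf {int g dmu : g in G, f <= g}].
    The resulting linear functional below [p] is positive, since [0] is in [G], hence
    is a Radon measure [nu] (Riesz), and [nu] precedes [mu]. By minimality
    [nu] and [mu] agree on [G], hence on [L], and the approximation gives
    [p f = int f dnu <= int f dmu]. The same approximation, applied to the
    truncations of [f], passes from continuous to upper semicontinuous [f]. For (iv)
    replace [f] by its supremum over fibres, which changes [f] only on a null set and
    does not change the set of [g] in [G] above [f]. Conversely, minimality follows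
    by testing (ii) on [f = - g]. *)
Require Import Defs.
From HB Require Import structures.
From mathcomp Require Import all_boot all_order all_algebra.
From mathcomp Require Import all_classical all_reals all_analysis.
From mathcomp Require Import Rstruct Rstruct_topology.
From mathcomp Require Import measurable_realfun ring lra.

Set Implicit Arguments.
Unset Strict Implicit.
Unset Printing Implicit Defensive.

Import Order.TTheory GRing.Theory Num.Theory.
Import numFieldNormedType.Exports.
Local Open Scope classical_set_scope.
Local Open Scope ring_scope.

(** * Hahn-Banach *)

Section HahnBanach.
Context {V : lmodType R} (S : set V).
Hypotheses (SD : forall x y, S x -> S y -> S (x + y))
  (SZ : forall t x, S x -> S (t *: x)) (S0 : S 0).
Implicit Types (p q : V -> R) (x y : V).

(** All conditions are relative to the subspace [S], so that a functional controlled only on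
    continuous functions qualifies. The one inequality for [t > 0] already yields homogeneity, by
    applying it to [t^-1] as well. *)
Definition sublinear_on q :=
  (forall x y, S x -> S y -> q (x + y) <= q x + q y) /\
  (forall t x, 0 < t -> S x -> q (t *: x) <= t * q x).

Lemma sublinear_on0 q : sublinear_on q -> q 0 = 0.
Proof.
(* The factor 2 gives [0 <= q 0], the factor 1/2 gives [q 0 <= 0]. *)
move=> [_ qZ]; have := qZ 2 0 ltac:(lra) S0; have := qZ 2^-1 0 ltac:(lra) S0.
rewrite !scaler0; lra.
Qed.

Lemma sublinear_onZ q t x : sublinear_on q -> 0 <= t -> S x ->
  q (t *: x) = t * q x.
Proof.
move=> qS; rewrite le_eqVlt => /orP[/eqP <- _|t0 Sx].
  by rewrite scale0r (sublinear_on0 qS) mul0r.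
apply/eqP; rewrite eq_le (proj2 qS)//=.
have := proj2 qS t^-1 (t *: x) ltac:(by rewrite invr_gt0) (SZ t Sx).
by rewrite scalerA mulVf ?gt_eqF// scale1r -(ler_pM2l t0) mulrA mulfV ?gt_eqF// mul1r.
Qed.

Lemma sublinear_on_oppr q x : sublinear_on q -> S x -> - q (- x) <= q x.
Proof.
move=> qS Sx; have Snx : S (- x) by rewrite -scaleN1r; exact: SZ.
by have := proj1 qS _ _ Snx Sx; rewrite addNr (sublinear_on0 qS); lra.
Qed.

(* Witness: the infimum over [t >= 0] of [q (x + t y) - t q y]. *)
Lemma sublinear_on_lower q y : sublinear_on q -> S y ->
  exists q', [/\ sublinear_on q', forall x, S x -> q' x <= q x
    & q' (- y) <= - q y].
Proof.
move=> qS Sy; have [qD qZ] := qS.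
pose E x := [set q (x + t *: y) - t * q y | t in [set t : R | 0 <= t]].
have SN (x : V) : S x -> S (- x) by rewrite -scaleN1r; exact: SZ.
(* The bound comes from [q (t *: y) <= q (x + t *: y) + q (- x)]. *)
have Eb x : S x -> has_lbound (E x).
  move=> Sx; exists (- q (- x)) => _ [t t0 <-].
  have := qD _ _ (SD Sx (SZ t Sy)) (SN _ Sx).
  by rewrite addrAC subrr add0r sublinear_onZ//; lra.
have E0 x : E x !=set0 by exists (q (x + 0 *: y) - 0 * q y); exists 0 => /=.
have Ele x t : S x -> 0 <= t -> inf (E x) <= q (x + t *: y) - t * q y.
  by move=> Sx t0; apply: ge_inf; [exact: Eb|exists t].
exists (fun x => inf (E x)); split.
- split=> [x x' Sx Sx'|s x s0 Sx].
  + rewrite /= -lerBlDr; apply: lb_le_inf => // _ [t t0 <-].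
    suff : inf (E (x + x')) - (q (x + t *: y) - t * q y) <= inf (E x') by lra.
    apply: lb_le_inf => // _ [t' t'0 <-]; rewrite lerBlDr.
    (* Terms with parameters [t] for [x] and [t'] for [x'] are compared with the term of parameter
       [t + t'] for [x + x']. *)
    apply: le_trans (Ele _ (t + t') (SD Sx Sx') _) _.
      by rewrite addr_ge0.
    have := qD _ _ (SD Sx (SZ t Sy)) (SD Sx' (SZ t' Sy)).
    by rewrite addrACA -scalerDl; lra.
  + rewrite /= mulrC -ler_pdivrMr//; apply: lb_le_inf => // _ [t t0 <-].
    rewrite ler_pdivrMr//; apply: le_trans (Ele _ (s * t) (SZ s Sx) _) _.
      by rewrite mulr_ge0// ltW.
    by have := qZ s _ s0 (SD Sx (SZ t Sy)); rewrite scalerDr scalerA; lra.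
- by move=> x Sx; have := Ele x 0 Sx (lexx _); rewrite scale0r addr0; lra.
- by have := Ele (- y) 1 (SN _ Sy) ler01; rewrite scale1r addNr sublinear_on0//; lra.
Qed.

Let below p := {q | sublinear_on q /\ forall x, S x -> q x <= p x}.

(** Zorn's lemma for the reversed pointwise order on [S]; a nonempty chain is bounded by its
    pointwise infimum. The order is only a preorder, as functions that agree on [S] need not be
    equal. *)
Lemma minimal_sublinear_on p : sublinear_on p ->
  exists q, [/\ sublinear_on q, forall x, S x -> q x <= p x &
    forall q', sublinear_on q' -> (forall x, S x -> q' x <= q x) ->
      forall x, S x -> q x <= q' x].
Proof.
move=> pS.
pose leS (a b : below p) := `[< forall x, S x -> sval b x <= sval a x >].
pose p0 : below p := exist _ p (conj pS (fun x _ => lexx (p x))).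
have [||A Atot|[q [qS qp]] qmin] := @ZL_preorder (below p) p0 leS.
- by move=> t; apply/asboolP.
- move=> r s t /asboolP rs /asboolP st; apply/asboolP => x Sx.
  exact: le_trans (st x Sx) (rs x Sx).
- have [A0|/set0P[a0 Aa0]] := eqVneq A set0; first by exists p0 => s; rewrite A0.
  pose E x := [set sval a x | a in A].
  have E0 x : E x !=set0 by exists (sval a0 x); exists a0.
  have Eb x : S x -> has_lbound (E x).
    move=> Sx; exists (- p (- x)) => _ [[a [aS ap]] Aa <-] /=.
    have Snx : S (- x) by rewrite -scaleN1r; exact: SZ.
    by have := sublinear_on_oppr aS Sx; have := ap _ Snx; lra.
  have Ele x a : S x -> A a -> inf (E x) <= sval a x.
    by move=> Sx Aa; apply: ge_inf; [exact: Eb|exists a].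
  have iS : sublinear_on (fun x => inf (E x)).
    split=> [x y Sx Sy|t x t0 Sx].
    + rewrite /= -lerBlDr; apply: lb_le_inf => // _ [a Aa <-].
      suff : inf (E (x + y)) - sval a x <= inf (E y) by lra.
      apply: lb_le_inf => // _ [b Ab <-]; rewrite lerBlDr.
      (* The smaller of the two members of the chain is below both, so its own subadditivity bounds
         the infimum at [x + y] by [sval a x + sval b y]. *)
      have [/asboolP ab|/asboolP ba] := Atot a b Aa Ab.
      * apply: le_trans (Ele _ b (SD Sx Sy) Ab) _.
        by have := proj1 (proj1 (svalP b)) _ _ Sx Sy; have := ab x Sx; lra.
      * apply: le_trans (Ele _ a (SD Sx Sy) Aa) _.
        by have := proj1 (proj1 (svalP a)) _ _ Sx Sy; have := ba y Sy; lra.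
    + rewrite /= mulrC -ler_pdivrMr//; apply: lb_le_inf => // _ [a Aa <-].
      rewrite ler_pdivrMr// mulrC; apply: le_trans (Ele _ a (SZ t Sx) Aa) _.
      exact: (proj2 (proj1 (svalP a))).
  have ip x : S x -> inf (E x) <= p x.
    by move=> Sx; apply: le_trans (Ele x a0 Sx Aa0) _; exact: (proj2 (svalP a0)).
  pose i0 : below p := exist _ (fun x => inf (E x)) (conj iS ip).
  by exists i0 => a Aa; apply/asboolP => x Sx /=; exact: Ele.
- exists q; split=> // q' q'S q'q.
  have q'p x (Sx : S x) : q' x <= p x := le_trans (q'q x Sx) (qp x Sx).
  have /asboolP := qmin (exist _ q' (conj q'S q'p)) ltac:(by apply/asboolP).
  exact.
Qed.

(** A minimal sublinear function is odd, since lowering it at [x] by [sublinear_on_lower] cannot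
    make it smaller, and an odd sublinear function is linear. Lowering [p] at [y] beforehand forces
    the value at [y] to be [p y]. *)
Theorem hahn_banach p y : sublinear_on p -> S y ->
  exists phi : V -> R, [/\ forall x x', S x -> S x' -> phi (x + x') = phi x + phi x',
    forall t x, S x -> phi (t *: x) = t * phi x,
    forall x, S x -> phi x <= p x & phi y = p y].
Proof.
move=> pS Sy; have [p' [p'S p'p p'y]] := sublinear_on_lower pS Sy.
have [q [qS qp' qmin]] := minimal_sublinear_on p'S.
have SN (x : V) : S x -> S (- x) by rewrite -scaleN1r; exact: SZ.
have qN x : S x -> q (- x) = - q x.
  move=> Sx; have [q' [q'S q'q q'x]] := sublinear_on_lower qS Sx.
  have := sublinear_on_oppr qS (SN _ Sx); rewrite opprK.
  by have := qmin _ q'S q'q _ (SN _ Sx); lra.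
exists q; split.
(* Oddness turns subadditivity at [- x] and [- x'] into superadditivity at [x] and [x']. *)
- move=> x x' Sx Sx'; have := proj1 qS _ _ Sx Sx'.
  have := proj1 qS _ _ (SN _ Sx) (SN _ Sx').
  by rewrite -opprD !qN//; [lra|exact: SD].
- move=> t x Sx; have [t0|t0] := leP 0 t; first exact: sublinear_onZ.
  rewrite -[t]opprK scaleNr qN; last exact: SZ.
  by rewrite sublinear_onZ ?oppr_ge0 ?ltW//; ring.
- by move=> x Sx; apply: le_trans (qp' x Sx) (p'p x Sx).
- apply/eqP; rewrite eq_le (le_trans (qp' y Sy) (p'p y Sy))/=.
  by have := qp' _ (SN _ Sy); rewrite qN//; lra.
Qed.
End HahnBanach.

(** * Integration on compact spaces *)

(** If [P F] failed, the sets [B] with [P] true of the part of [F] outside [B] would form a proper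
    filter containing [F]. It would have a cluster point in [F], and a neighbourhood [U] of that
    point with [P U] would have to meet its own complement. *)
Lemma compact_induction (T : topologicalType) (F : set T) (P : set T -> Prop) :
  compact F -> P set0 -> (forall A B, A `<=` B -> P B -> P A) ->
  (forall A B, P A -> P B -> P (A `|` B)) ->
  (forall x, F x -> exists2 U, nbhs x U & P U) -> P F.
Proof.
move=> cF P0 Psub PU Ploc; apply: contrapT => nPF.
pose Fil : set_system T := [set B | P (F `\` B)].
have FilP : ProperFilter Fil.
  apply: Build_ProperFilter_ex => [B PFB|].
    apply: contrapT => nB; apply: nPF; apply: Psub PFB => x Fx; split => // Bx.
    by apply: nB; exists x.
  split=> [|A B|A B AB].
  - by rewrite /Fil /= setDT.
  - by rewrite /Fil /= setDIr; exact: PU.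
  - by apply: Psub; exact: setDS.
have [|x [Fx clx]] := cF Fil FilP; first by rewrite /Fil /= setDv.
have [U Ux PU'] := Ploc x Fx.
have [|y [[Fy nUy] Uy]] := clx (F `\` U) U _ Ux; last exact: nUy.
by apply: Psub PU' => y [Fy /not_andP[//|/contrapT]].
Qed.

Lemma urysohn_fun (T : topologicalType) (A B : set T) :
  compact [set: T] -> hausdorff_space T ->
  closed A -> closed B -> A `&` B = set0 ->
  exists f : T -> R, [/\ continuous f, forall x, 0 <= f x <= 1,
    forall x, A x -> f x = 0 & forall x, B x -> f x = 1].
Proof.
move=> cT hT cA cB AB0.
have /(@normal_separatorP R)/(_ A B cA cB AB0) := compact_normal hT cT.
move=> /(@uniform_separatorP _ R)[f [cf f01 fA fB]].
exists f; split=> // [x|x Ax|x Bx]; last 2 first.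
- by apply: fA; exists x.
- by apply: fB; exists x.
by have /= := f01 (f x); rewrite in_itv /=; apply; exists x.
Qed.

(* The topological structures on Stdlib's reals are only found through [R^o]. *)
Section RealContinuous.
Context {T : topologicalType}.
Implicit Types f g : T -> R.

Lemma continuous_Rcst c : continuous (fun _ : T => c : R).
Proof. by move=> x; exact: cvg_cst. Qed.

Lemma continuous_RD f g : continuous f -> continuous g ->
  continuous (fun x => f x + g x).
Proof. by move=> cf cg x; exact: (@continuousD R R^o T f g x (cf x) (cg x)). Qed.

Lemma continuous_RZ t f : continuous f -> continuous (fun x => t * f x).
Proof.
move=> cf x; exact: (@continuousM R T (fun _ => t) f x (@continuous_Rcst t x) (cf x)).
Qed.

Lemma continuous_RM f g : continuous f ->
  continuous g -> continuous (fun x => f x * g x).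
Proof. by move=> cf cg x; exact: (@continuousM R T f g x (cf x) (cg x)). Qed.

Lemma continuous_RN f : continuous f -> continuous (fun x => - f x).
Proof. by move=> cf x; exact: (@continuousN R R^o T f x (cf x)). Qed.

Lemma continuous_Rmax f g : continuous f -> continuous g ->
  continuous (fun x => Num.max (f x) (g x)).
Proof. by move=> cf cg x; exact: (@continuous_max R T f g x (cf x) (cg x)). Qed.

Lemma continuous_Rmin f g : continuous f -> continuous g ->
  continuous (fun x => Num.min (f x) (g x)).
Proof. by move=> cf cg x; exact: (@continuous_min R T f g x (cf x) (cg x)). Qed.
End RealContinuous.

Lemma continuous_usc (T : topologicalType) (f : T -> R) :
  continuous f -> upper_semicontinuous f.
Proof. by move=> cf x c fxc; exact: (cvgr_lt _ (cf x)). Qed.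

Lemma usc_open (T : topologicalType) (f : T -> R) c :
  upper_semicontinuous f -> open [set x | f x < c].
Proof. by move=> uf; rewrite openE => x fx; exact: uf. Qed.

Lemma usc_closed (T : topologicalType) (f : T -> R) c :
  upper_semicontinuous f -> closed [set x | c <= f x].
Proof.
move=> uf; rewrite (_ : [set x | _] = ~` [set x | f x < c]).
  exact/open_closedC/usc_open.
by apply/seteqP; split=> x /=; rewrite leNgt => /negP.
Qed.

Lemma usc_ubound (T : topologicalType) (f : T -> R) : compact [set: T] ->
  upper_semicontinuous f -> exists c : R, forall x, f x <= c.
Proof.
move=> cT uf; pose P (A : set T) := exists c : R, forall x, A x -> f x <= c.
have [||A B [a Pa] [b Pb]|x _|c fc] := @compact_induction _ setT P cT.
- by exists 0.
- by move=> A B AB [c Bc]; exists c => x /AB/Bc.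
- exists (Num.max a b) => x [/Pa|/Pb]; rewrite le_max => -> //.
  by rewrite orbT.
- exists [set y | f y < f x + 1]; first by apply: uf; lra.
  by exists (f x + 1) => y /ltW.
- by exists c => x; exact: fc.
Qed.

Lemma continuous_bounded (T : topologicalType) (f : T -> R) :
  compact [set: T] -> continuous f -> exists c : R, forall x, `|f x| <= c.
Proof.
move=> cT cf; have [a fa] := usc_ubound cT (continuous_usc cf).
have [b fb] := usc_ubound cT (continuous_usc (continuous_RN cf)).
exists (Num.max a b) => x; rewrite ler_norml le_max fa/= andbT.
have bM : b <= Num.max a b by rewrite le_max lexx orbT.
by have := fb x; lra.
Qed.

(** * Bounded Borel functions and their real-valued integrals *)

Section Integ.
Context {K : ptopologicalType}.
Implicit Types (mu : measureK K) (f g : K -> R).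

Lemma usc_measurable f : upper_semicontinuous f ->
  measurable_fun [set: BorelK K] (f : BorelK K -> measurableTypeR R).
Proof.
move=> uf; apply: (measurability (@RGenInftyO.G R)).
  exact: RGenInftyO.measurableE.
move=> _ [_ [c ->] <-]; rewrite setTI; apply: sub_sigma_algebra.
rewrite (_ : _ @^-1` _ = [set x | f x < c]); first exact: usc_open.
by apply/seteqP; split=> x /=; rewrite in_itv.
Qed.

Definition bdd_measurable f :=
  measurable_fun [set: BorelK K] (f : BorelK K -> measurableTypeR R) /\
  exists c : R, forall x, `|f x| <= c.

(** Faithful only when the integral is finite, since [fine] sends infinite values to 0; [integE]
    settles the bounded Borel case. *)
Definition intR mu f : R := fine (integ mu f).

Lemma continuous_bdd_measurable f : compact [set: K] -> continuous f -> bdd_measurable f.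
Proof.
move=> cK cf; split; first by apply: usc_measurable; exact: continuous_usc.
exact: continuous_bounded.
Qed.

Variables (mu : measureK K) (mufin : (mu setT < +oo)%E).

Lemma bdd_measurable_integrable f : bdd_measurable f ->
  mu.-integrable [set: BorelK K] (EFin \o (f : BorelK K -> R)).
Proof.
move=> [mf [c fc]]; apply: measurable_bounded_integrable => //.
exists c; split; rewrite ?num_real// => d cd x _ /=.
exact: le_trans (fc x) (ltW cd).
Qed.

Lemma integE f : bdd_measurable f -> integ mu f = (intR mu f)%:E.
Proof.
move=> mf; rewrite /intR fineK//; apply: integrable_fin_num => //.
exact: bdd_measurable_integrable.
Qed.

Lemma le_intR f g : bdd_measurable f -> bdd_measurable g ->
  (forall x, f x <= g x) -> intR mu f <= intR mu g.
Proof. by move=> mf mg fg; apply: le_Rintegral => //; exact: bdd_measurable_integrable. Qed.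

Lemma intRD f g : bdd_measurable f -> bdd_measurable g ->
  intR mu (f \+ g) = intR mu f + intR mu g.
Proof. by move=> mf mg; apply: RintegralD => //; exact: bdd_measurable_integrable. Qed.

Lemma intRZ t f : bdd_measurable f -> intR mu (fun x => t * f x) = t * intR mu f.
Proof. by move=> mf; apply: RintegralZl => //; exact: bdd_measurable_integrable. Qed.

Lemma intRcst t : intR mu (fun _ => t) = t * intR mu (fun _ => 1).
Proof.
have /(intRZ t) <- : bdd_measurable (fun _ => 1).
  by split; [exact: measurable_cst|exists 1 => _; rewrite normr1].
by congr intR; apply/funext => x; rewrite mulr1.
Qed.

Lemma bdd_measurable_D f g : bdd_measurable f -> bdd_measurable g ->
  bdd_measurable (f \+ g).
Proof.
move=> [mf [c fc]] [mg [c' gc]]; split; first exact: measurable_funD.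
by exists (c + c') => x /=; apply: le_trans (ler_normD _ _) _; exact: lerD.
Qed.

Lemma bdd_measurable_Z t f : bdd_measurable f -> bdd_measurable (fun x => t * f x).
Proof.
move=> [mf [c fc]]; split; first by apply: measurable_funM => //; exact: measurable_cst.
by exists (`|t| * c) => x /=; rewrite normrM ler_wpM2l.
Qed.

Lemma bdd_measurable_cst t : bdd_measurable (fun _ => t).
Proof. by split; [exact: measurable_cst|exists `|t| => _]. Qed.

Lemma bdd_measurable_sum n (f : nat -> K -> R) : (forall k, bdd_measurable (f k)) ->
  bdd_measurable (fun x => \sum_(k < n) f k x).
Proof.
move=> mf; elim: n => [|n ih].
  by under eq_fun do rewrite big_ord0; exact: bdd_measurable_cst.
by under eq_fun do rewrite big_ord_recr/=; exact: bdd_measurable_D.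
Qed.

Lemma intRsum n (f : nat -> K -> R) : (forall k, bdd_measurable (f k)) ->
  intR mu (fun x => \sum_(k < n) f k x) = \sum_(k < n) intR mu (f k).
Proof.
move=> mf; elim: n => [|n ih].
  rewrite big_ord0; under eq_fun do rewrite big_ord0.
  by rewrite intRcst mul0r.
rewrite big_ord_recr/= -ih -intRD//; last exact: bdd_measurable_sum.
by congr intR; apply/funext => x; rewrite big_ord_recr.
Qed.

Lemma borel_measurable (A : set K) : borel A -> measurable (A : set (BorelK K)).
Proof. by []. Qed.

Lemma bdd_measurable_indic (A : set K) : borel A -> bdd_measurable (\1_A : K -> R).
Proof.
move=> bA; split; first exact: (@measurable_indic _ (BorelK K)).
by exists 1 => x; rewrite indicE; case: (_ \in _); rewrite ?normr1 ?normr0.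
Qed.

Lemma mu_fin_num (A : set K) : borel A -> mu A \is a fin_num.
Proof.
move=> bA; rewrite ge0_fin_numE//; apply: le_lt_trans mufin.
by apply: le_measure; rewrite ?inE//; exact: borel_measurable.
Qed.

Lemma intRindic (A : set K) : borel A -> intR mu (\1_A : K -> R) = fine (mu A).
Proof.
by move=> bA; rewrite /intR /integ integral_indic// ?setIT//; exact: borel_measurable.
Qed.

Lemma intR1 : intR mu (fun _ => 1) = fine (mu setT).
Proof. by rewrite /intR /integ integral_cst// mul1e. Qed.

Lemma borel_open (A : set K) : open A -> borel A.
Proof. exact: sub_sigma_algebra. Qed.

Lemma borel_closed (A : set K) : closed A -> borel A.
Proof.
move=> cA; rewrite -[A]setCK; apply: (@measurableC _ (BorelK K)).
by apply: borel_open; exact: closed_openC.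
Qed.

(** The sum counts the naturals [k < n] with [k <= t]. For [t >= 0] this is the minimum of [n] and
    the integer part of [t] plus one, whence this bound and the next. *)
Lemma layer_sum_ge n (t : R) : Num.min t n%:R <= \sum_(k < n) (k%:R <= t)%R%:R.
Proof.
elim: n => [|n ih]; first by rewrite big_ord0 ge_min lexx orbT.
rewrite big_ord_recr/= -natr1; move: ih; rewrite !ge_min.
case: (leP n%:R t) => nt /=; rewrite ?mulr1n ?mulr0n.
  by case/orP=> ?; apply/orP; right; lra.
by case/orP=> ?; apply/orP; left; lra.
Qed.

Lemma layer_sum_le n (t : R) : 0 <= t -> \sum_(k < n) (k%:R <= t)%R%:R <= t + 1 :> R.
Proof.
(* The extra bound by [n] carries the induction: when [n <= t], the new term 1 still fits below
   [t + 1]. *)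
move=> t0; suff : \sum_(k < n) (k%:R <= t)%R%:R <= Num.min n%:R (t + 1) :> R.
  by rewrite le_min => /andP[].
elim: n => [|n ih]; first by rewrite big_ord0 le_min lexx; lra.
rewrite big_ord_recr/= -natr1; move: ih; rewrite !le_min => /andP[h1 h2].
by case: (leP n%:R t) => nt /=; rewrite ?mulr1n ?mulr0n; apply/andP; split; lra.
Qed.

End Integ.

(** * The lattice G - G *)

Section Cone.
Context {M : Type} (d : M -> M -> R) (hmet : is_metric d).
Context {K : ptopologicalType} (e : Mt M -> K) (cK : compact [set: K]).
Implicit Types (f g h : K -> R).

Let d0 x y : 0 <= d x y.
Proof. by case: hmet. Qed.

Lemma inG_cst c : 0 <= c -> inG d e (fun _ => c).
Proof.
move=> c0; split; first exact: continuous_Rcst.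
move=> a b w -> ab <-; rewrite ab -mulrDl ler_wpM2r//.
by case: hmet => _ _ _; apply.
Qed.

Lemma inG_D f g : inG d e f -> inG d e g -> inG d e (fun x => f x + g x).
Proof.
move=> [cf fG] [cg gG]; split; first exact: continuous_RD.
move=> a b c h1 h2 h3; have := fG a b c h1 h2 h3; have := gG a b c h1 h2 h3.
by rewrite !mulrDr; lra.
Qed.

Lemma inG_Z t g : 0 <= t -> inG d e g -> inG d e (fun x => t * g x).
Proof.
move=> t0 [cg gG]; split; first exact: continuous_RZ.
move=> a b c h1 h2 h3; have := ler_wpM2l t0 (gG a b c h1 h2 h3).
by rewrite mulrDr !(mulrCA t).
Qed.

Lemma inG_max f g : inG d e f -> inG d e g -> inG d e (fun x => Num.max (f x) (g x)).
Proof.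
move=> [cf fG] [cg gG]; split; first exact: continuous_Rmax.
move=> a b c h1 h2 h3; rewrite maxr_pMr//= ge_max; apply/andP; split.
- apply: le_trans (fG a b c h1 h2 h3) _.
  by apply: lerD; rewrite ler_wpM2l// le_max lexx.
- apply: le_trans (gG a b c h1 h2 h3) _.
  by apply: lerD; rewrite ler_wpM2l// le_max lexx orbT.
Qed.

Definition inL h := exists u v, [/\ inG d e u, inG d e v & h = (fun x => u x - v x)].

Lemma inL_inG g : inG d e g -> inL g.
Proof.
move=> gG; exists g, (fun _ => 0); split=> //; first exact: inG_cst.
by apply/funext => x; rewrite subr0.
Qed.

Lemma inL_N h : inL h -> inL (fun x => - h x).
Proof.
by move=> [u [v [uG vG ->]]]; exists v, u; split=> //; apply/funext => x; rewrite opprB.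
Qed.

Lemma inL_cst c : inL (fun _ => c).
Proof.
have [c0|c0] := leP 0 c; first exact/inL_inG/inG_cst.
rewrite -[c]opprK; apply: (@inL_N (fun _ => - c)).
by apply/inL_inG/inG_cst; rewrite oppr_ge0 ltW.
Qed.

Lemma inL_D f g : inL f -> inL g -> inL (fun x => f x + g x).
Proof.
move=> [u [v [uG vG ->]]] [u' [v' [u'G v'G ->]]].
exists (fun x => u x + u' x), (fun x => v x + v' x); split; try exact: inG_D.
by apply/funext => x; ring.
Qed.

Lemma inL_Z t h : inL h -> inL (fun x => t * h x).
Proof.
move=> hL; wlog t0 : t / 0 <= t => [hw|].
  have [/hw//|t0] := leP 0 t; rewrite (_ : (fun x => _) = fun x => - (- t * h x)).
    by apply: inL_N; apply: hw; rewrite oppr_ge0 ltW.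
  by apply/funext => x; ring.
move: hL => [u [v [uG vG ->]]].
exists (fun x => t * u x), (fun x => t * v x); split; try exact: inG_Z.
by apply/funext => x; ring.
Qed.

(** The maximum of [u - v] and [u' - v'] is the maximum of [u + v'] and [u' + v], minus [v + v'];
    the cone itself is stable under maxima. *)
Lemma inL_max f g : inL f -> inL g -> inL (fun x => Num.max (f x) (g x)).
Proof.
move=> [u [v [uG vG ->]]] [u' [v' [u'G v'G ->]]].
exists (fun x => Num.max (u x + v' x) (u' x + v x)), (fun x => v x + v' x).
split; [apply: inG_max; exact: inG_D|exact: inG_D|].
by apply/funext => x; rewrite addr_maxl; congr Num.max; ring.
Qed.

Lemma inL_min f g : inL f -> inL g -> inL (fun x => Num.min (f x) (g x)).
Proof.
move=> fL gL; rewrite (_ : (fun x => _) = fun x => - Num.max (- f x) (- g x)).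
  by apply/inL_N/inL_max; exact: inL_N.
by apply/funext => x; rewrite oppr_max !opprK.
Qed.

Lemma inL_norm h : inL h -> inL (fun x => `|h x|).
Proof.
move=> hL; rewrite (_ : (fun x => _) = fun x => Num.max (h x) (- h x)).
  by apply: inL_max => //; exact: inL_N.
by apply/funext => x; rewrite maxrN.
Qed.

Lemma inL_sum n (h : nat -> K -> R) : (forall k, inL (h k)) ->
  inL (fun x => \sum_(k < n) h k x).
Proof.
move=> hL; elim: n => [|n ih].
  by under eq_fun do rewrite big_ord0; exact: inL_cst.
by under eq_fun do rewrite big_ord_recr/=; exact: inL_D.
Qed.

Lemma inL_continuous h : inL h -> continuous h.
Proof.
move=> [u [v [[cu _] [cv _] ->]]].
by apply: continuous_RD => //; exact: continuous_RN.
Qed.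

Lemma inL_bdd_measurable h : inL h -> bdd_measurable h.
Proof. by move=> /inL_continuous; exact: continuous_bdd_measurable. Qed.

Lemma inL_sim h z w : inL h -> Gsim d e z w -> h z = h w.
Proof.
by move=> [u [v [uG vG ->]]] /asboolP zw; rewrite (zw u uG) (zw v vG).
Qed.

(** For each [w] in [F] some [g] in the cone has [g w <> g z], and a multiple of [|g - g z|] exceeds
    1 near [w]. By compactness finitely many such functions suffice, and they are added. *)
Lemma inL_separation (F : set K) z : closed F ->
  (forall w, F w -> ~~ Gsim d e z w) ->
  exists h, [/\ inL h, forall x, 0 <= h x, h z = 0 & forall w, F w -> 1 <= h w].
Proof.
move=> cF zF; pose P (A : set K) :=
  exists h, [/\ inL h, forall x, 0 <= h x, h z = 0 & forall w, A w -> 1 <= h w].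
have cpF : compact F by apply: subclosed_compact cF cK _.
apply: (@compact_induction _ F P cpF).
- by exists (fun _ => 0); split=> //; exact: inL_cst.
- by move=> A B AB [h [hL h0 hz hB]]; exists h; split=> // w /AB/hB.
- move=> A B [f [fL f0 fz fA]] [g [gL g0 gz gB]].
  exists (fun x => f x + g x); split; first exact: inL_D.
  + by move=> x; rewrite addr_ge0.
  + by rewrite fz gz addr0.
  + by move=> w [/fA|/gB]; have := f0 w; have := g0 w; lra.
- move=> w /zF /asboolPn; move/existsNP => [g /not_implyP[gG gzw]].
  pose r := `|g w - g z|.
  have r0 : 0 < r by rewrite normr_gt0 subr_eq0; apply/eqP => /esym.
  (* The factor makes [h w = 2], so that [1 < h] holds on a neighbourhood of [w]. *)
  pose h x := 2 / r * `|g x - g z|.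
  have hL : inL h.
    by apply/inL_Z/inL_norm/inL_D; [exact: inL_inG|exact: inL_cst].
  exists [set x | 1 < h x]; last first.
    exists h; split=> //; last by move=> x /ltW.
      by move=> x; rewrite mulr_ge0// divr_ge0// ltW.
    by rewrite /h subrr normr0 mulr0.
  have hw : 1 < h w by rewrite /h -/r mulfVK ?gt_eqF//; lra.
  exact: (cvgr_gt (h w) (inL_continuous hL (x:=w)) 1 hw).
Qed.

(** * Approximation from above in mean by elements of the lattice *)

Section Measure.
Variables (mu : measureK K) (rmu : radon mu).
Let mufin : (mu setT < +oo)%E := let: And3 h _ _ := rmu in h.

Definition saturated (F : set K) := forall z w, Gsim d e z w -> F w -> F z.

(* [F] is the intersection of the sets [h >= 1] with [h] in [L], [h >= 1] on [F];
   compactness of the complement of a neighbourhood reduces this to one [h]. *)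
Lemma inL_approx_closed (F : set K) eps : closed F -> saturated F -> 0 < eps ->
  exists h, [/\ inL h, forall x, \1_F x <= h x & intR mu h <= intR mu \1_F + eps].
Proof.
move=> cF sF eps0; have [_ mu_outer _] := rmu.
have bF := borel_closed cF; have Ffin := mu_fin_num mufin bF.
have [U [oU FU muU]] : exists U, [/\ open U, F `<=` U & (mu U <= mu F + eps%:E)%E].
  have infin : ereal_inf [set mu U | U in [set U : set K | open U /\ F `<=` U]]
    \is a fin_num by rewrite -mu_outer.
  have [_ [U [oU FU] <-]] := lb_ereal_inf_adherent eps0 infin.
  by rewrite -mu_outer// => /ltW; exists U.
pose P (A : set K) := exists h, [/\ inL h, forall x, 0 <= h x <= 1,
  forall x, F x -> h x = 1 & forall x, A x -> h x = 0].
have cU : compact (~` U) by apply: (subclosed_compact (open_closedC oU) cK).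
have [|A B AB|A B|x nUx|h [hL h01 hF hU]] := @compact_induction _ (~` U) P cU.
- by exists (fun _ => 1); split=> //; [exact: inL_cst|move=> x; lra].
- by move=> [h [hL h01 hF hB]]; exists h; split=> // x /AB/hB.
- move=> [f [fL f01 fF fA]] [g [gL g01 gF gB]].
  exists (fun x => Num.min (f x) (g x)); split; first exact: inL_min.
  + move=> x; have /andP[f0 f1] := f01 x; have /andP[g0 g1] := g01 x.
    by rewrite le_min f0 g0 ge_min f1.
  + by move=> x Fx; rewrite fF// gF// minxx.
  + move=> x; have /andP[f0 f1] := f01 x; have /andP[g0 g1] := g01 x.
    by move=> [/fA ->|/gB ->]; [rewrite min_l|rewrite min_r].
- have [|h [hL h0 hx hF]] := @inL_separation F x cF.
    by move=> w Fw; apply/negP => /sF/(_ Fw)/FU.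
  (* [k] is 1 where [h >= 1], hence on [F], and 0 where [h <= 1/2], hence near [x]. *)
  pose k y := Num.min 1 (Num.max 0 (2 * h y - 1)).
  exists [set y | h y < 2^-1].
    have hx' : h x < 2^-1 by rewrite hx; lra.
    exact: (cvgr_lt (h x) (inL_continuous hL (x:=x)) _ hx').
  exists k; split.
  + apply: inL_min; first exact: inL_cst; apply: inL_max; first exact: inL_cst.
    by apply: inL_D; [exact: inL_Z|exact: inL_cst].
  + by move=> y; rewrite /k le_min ge_min lexx/= ler01 le_max lexx.
  + by move=> y /hF hy; rewrite /k min_l// le_max; apply/orP; right; lra.
  + by move=> y /= hy; rewrite /k max_l ?min_r//; lra.
- exists h; split=> //.
  + move=> x; rewrite indicE; case: (boolP (x \in F)) => [/set_mem/hF ->//|_].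
    by have /andP[] := h01 x.
  + have bU := borel_open oU; rewrite intRindic//.
    apply: (@le_trans _ _ (intR mu \1_U)).
      apply: le_intR => //; [exact: inL_bdd_measurable|exact: bdd_measurable_indic|].
      move=> x.
      rewrite indicE; case: (boolP (x \in U)) => [_|/negP nUx].
        by have /andP[] := h01 x.
      by rewrite hU// => Ux; apply: nUx; rewrite inE.
    rewrite intRindic// -lee_fin EFinD !fineK//; exact: mu_fin_num.
Qed.

(* Layer cake: [m f] is, up to [1], the sum of the indicators of [k <= m f]. *)
Lemma inL_approx_usc f eps : upper_semicontinuous f ->
  (forall z w, Gsim d e z w -> f z = f w) -> bdd_measurable f -> 0 < eps ->
  exists h, [/\ inL h, forall x, f x <= h x & intR mu h <= intR mu f + eps].
Proof.
move=> uf sf mf eps0.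
wlog f0 : f uf sf mf / forall x, 0 <= f x => [hw|].
  have [_ [c fc]] := mf.
  have [||||h [hL fh Ih]] := hw (fun x => f x + c).
  - move=> x t; rewrite -ltrBrDr => /uf; apply: filterS => y; lra.
  - by move=> z w zw; rewrite (sf z w zw).
  - by apply: bdd_measurable_D => //; exact: bdd_measurable_cst.
  - by move=> x; have := fc x; rewrite ler_norml; lra.
  exists (fun x => h x + - c); split; first by apply: inL_D => //; exact: inL_cst.
    by move=> x; have := fh x; lra.
  rewrite (intRD mufin (inL_bdd_measurable hL) (bdd_measurable_cst (- c))) (intRcst mufin).
  by move: Ih; rewrite (intRD mufin mf (bdd_measurable_cst c)) (intRcst mufin c); lra.
have [_ [c fc]] := mf; pose m0 := intR mu (fun _ => 1).
have m00 : 0 <= m0 by rewrite /m0 intR1; apply: fine_ge0.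
(* The total error is [(m0 + 1) / m]: [m0] from rounding [m f] up to a sum of indicators, and 1 from
   [n] approximations within [1 / n] each. *)
have [m mP] : exists m : nat, 0 < m%:R :> R /\ (m0 + 1) / m%:R <= eps.
  exists (Num.trunc ((m0 + 1) / eps)).+1; split; first by rewrite ltr0n.
  rewrite ler_pdivrMr ?ltr0n// mulrC -ler_pdivrMr//; apply: ltW.
  by apply: Num.Theory.truncnS_gt.
(* With [n > m c] the layers exhaust all of [m f]. *)
pose n := (Num.trunc (m%:R * c)).+1.
pose F k := [set x | k%:R / m%:R <= f x].
have bF k : borel (F k) by apply: borel_closed; exact: usc_closed.
have [k|h hP] := @choice _ _ (fun k (g : K -> R) => [/\ inL g,
    forall x, \1_(F k) x <= g x & intR mu g <= intR mu \1_(F k) + n%:R^-1]).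
  apply: inL_approx_closed.
  - exact: usc_closed.
  - by move=> z w zw; rewrite /F /= (sf z w zw).
  - by rewrite invr_gt0 ltr0n.
have FE k x : \1_(F k) x = (k%:R <= m%:R * f x)%R%:R :> R.
  rewrite indicE; congr (nat_of_bool _)%:R.
  by apply/idP/idP; rewrite inE /F /= ler_pdivrMr ?(proj1 mP)// mulrC.
exists (fun x => m%:R^-1 * \sum_(k < n) h k x); split.
- by apply/inL_Z/inL_sum => k; have [] := hP k.
- move=> x; rewrite mulrC ler_pdivlMr ?(proj1 mP)// mulrC.
  apply: (@le_trans _ _ (\sum_(k < n) \1_(F k) x)); last first.
    by apply: ler_sum => k _; have [_ /(_ x)] := hP k.
  under eq_bigr do rewrite FE.
  apply: le_trans (layer_sum_ge n (m%:R * f x)); rewrite le_min lexx/=.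
  apply: (@le_trans _ _ (m%:R * c)).
    by rewrite ler_pM2l ?(proj1 mP)//; apply: le_trans (fc x); exact: ler_norm.
  by apply: ltW; exact: Num.Theory.truncnS_gt.
- have bh k : bdd_measurable (h k) by have [/inL_bdd_measurable] := hP k.
  have b1 k : bdd_measurable (\1_(F k)) by exact: bdd_measurable_indic.
  rewrite intRZ//; last exact: bdd_measurable_sum.
  rewrite intRsum// mulrC ler_pdivrMr ?(proj1 mP)//.
  apply: (@le_trans _ _ (\sum_(k < n) (intR mu \1_(F k) + n%:R^-1))).
    by apply: ler_sum => k _; have [] := hP k.
  rewrite big_split/= sumr_const card_ord -[_ *+ n]mulr_natr mulVf ?pnatr_eq0//.
  rewrite -(intRsum mufin n b1).
  have : intR mu (fun x => \sum_(k < n) \1_(F k) x) <= intR mu (fun x => m%:R * f x + 1).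
    apply: le_intR => //; first exact: (bdd_measurable_sum n b1).
      by apply: bdd_measurable_D; [exact: bdd_measurable_Z|exact: bdd_measurable_cst].
    move=> x; under eq_bigr do rewrite FE.
    by apply: layer_sum_le; rewrite mulr_ge0.
  rewrite (intRD mufin (bdd_measurable_Z _ mf) (bdd_measurable_cst _)) intRZ// -/m0.
  have := proj2 mP; rewrite ler_pdivrMr ?(proj1 mP)//; lra.
Qed.
End Measure.
End Cone.

(** * The Riesz representation theorem *)

Section Riesz.
Context {K : ptopologicalType} (cK : compact [set: K]) (hK : hausdorff_space K).
Variable phi : (K -> R) -> R.
Hypotheses
  (phiD : forall f g : K -> R, continuous f -> continuous g ->
     phi (fun x => f x + g x) = phi f + phi g)
  (phiZ : forall (t : R) (f : K -> R), continuous f -> phi (fun x => t * f x) = t * phi f)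
  (phi_ge0 : forall f : K -> R, continuous f -> (forall x, 0 <= f x) -> 0 <= phi f).
Implicit Types (f g : K -> R) (U V W A : set K).

Let c1 : continuous (fun _ : K => 1 : R). Proof. exact: continuous_Rcst. Qed.

Let phi_cst c : phi (fun _ => c) = c * phi (fun _ => 1).
Proof. by rewrite -phiZ//; congr phi; apply/funext => x; rewrite mulr1. Qed.

Let phi_le f g : continuous f -> continuous g -> (forall x, f x <= g x) -> phi f <= phi g.
Proof.
move=> cf cg fg; have cN := continuous_RZ (t := -1) cf.
have : 0 <= phi (fun x => g x + -1 * f x).
  by apply: phi_ge0 => [|x]; [exact: continuous_RD|have := fg x; lra].
by rewrite phiD// phiZ//; lra.
Qed.

Let phi_sum n (f : nat -> K -> R) : (forall k, continuous (f k)) ->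
  continuous (fun x => \sum_(k < n) f k x) /\
  phi (fun x => \sum_(k < n) f k x) = \sum_(k < n) phi (f k).
Proof.
move=> cf; elim: n => [|n [ihc ih]].
  under eq_fun do rewrite big_ord0; rewrite big_ord0 phi_cst mul0r.
  by split=> //; exact: continuous_Rcst.
under eq_fun do rewrite big_ord_recr/=; rewrite big_ord_recr/= -ih.
by split; [exact: continuous_RD|rewrite phiD].
Qed.

Let m1_ge0 : 0 <= phi (fun _ => 1).
Proof. by apply: phi_ge0 => // x; exact: ler01. Qed.

(** Vanishing off [U] replaces the usual demand that the support lie in [U]; [cut] makes up for the
    difference. *)
Definition subordinate U f :=
  [/\ continuous f, forall x, 0 <= f x <= 1 & forall x, ~ U x -> f x = 0].

(** The future measure of the open set [U]; the supremum is finite, being bounded by [phi] of the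
    constant 1. *)
Definition lam U : R := sup [set phi f | f in subordinate U].

Let sub0 U : subordinate U (fun _ => 0).
Proof. by split=> // [|x]; [exact: continuous_Rcst|lra]. Qed.

Let phi_lam U f : subordinate U f -> phi f <= lam U.
Proof.
move=> Uf; apply: ub_le_sup; last by exists f.
exists (phi (fun _ => 1)) => _ [g [cg g01 _] <-]; apply: phi_le => // x.
by have /andP[] := g01 x.
Qed.

Let lam_le U c : (forall f, subordinate U f -> phi f <= c) -> lam U <= c.
Proof.
move=> h; apply: ge_sup; first by exists (phi (fun _ => 0)), (fun _ => 0).
by move=> _ [f /h fc <-].
Qed.

Let lam_ge0 U : 0 <= lam U.
Proof. by apply: le_trans (phi_lam (sub0 U)); rewrite phi_cst mul0r. Qed.

Let le_lam U V : U `<=` V -> lam U <= lam V.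
Proof.
move=> UV; apply: lam_le => f [cf f01 fU]; apply: phi_lam; split=> // x nV.
by apply: fU => /UV.
Qed.

Let lamT : lam setT = phi (fun _ => 1).
Proof.
apply/eqP; rewrite eq_le; apply/andP; split.
  by apply: lam_le => f [cf f01 _]; apply: phi_le => // x; have /andP[] := f01 x.
by apply: phi_lam; split=> [|x|x []]; [exact: c1|lra|].
Qed.

(** The function is nonzero only inside the compact set [f >= eps], which lies in [U] when [f] is
    subordinate to [U]. By [phi_cut] the price is [eps] times [phi] of the constant 1. *)
Definition cut (eps : R) f x : R := Num.max (f x - eps) 0.

Let cut_continuous eps f : continuous f -> continuous (cut eps f).
Proof.
move=> cf; apply: continuous_Rmax; last exact: continuous_Rcst.
by apply: continuous_RD => //; exact: continuous_Rcst.
Qed.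

Let cut01 eps f x : 0 <= eps -> 0 <= f x <= 1 -> 0 <= cut eps f x <= 1.
Proof. by move=> e0 f01; rewrite /cut; case: (leP (f x - eps) 0) => h; lra. Qed.

Let phi_cut eps f : continuous f -> phi f <= phi (cut eps f) + eps * phi (fun _ => 1).
Proof.
move=> cf; have cc := @cut_continuous eps _ cf; have ce := @continuous_Rcst K eps.
rewrite -phi_cst -phiD//; apply: phi_le => //; first exact: continuous_RD.
by move=> x; rewrite -lerBlDr le_max lexx.
Qed.

Let le_eps (a b : R) : (forall eps, 0 < eps -> a <= b + eps * phi (fun _ => 1)) -> a <= b.
Proof.
move=> h; apply/ler_addgt0Pr => eps eps0.
have m0 : 0 < phi (fun _ => 1) + 1 by have := m1_ge0; lra.
(* Adding 1 keeps the divisor positive when [phi] vanishes. *)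
apply: le_trans (h (eps / (phi (fun _ => 1) + 1)) _) _; first exact: divr_gt0.
by rewrite lerD2l mulrAC ler_pdivrMr// ler_pM2l//; lra.
Qed.

(* Split [f] as [f k + f (1 - k)], where the Urysohn function [k] vanishes off [V] and
   is [1] where [f >= eps] off [U]; [f (1 - k)] is then below [eps] off [U]. *)
Let lam_setU U V : open U -> open V -> lam (U `|` V) <= lam U + lam V.
Proof.
move=> oU oV; apply: lam_le => f [cf f01 fUV]; apply: le_eps => eps eps0.
(* [F] lies in [V], because [f] vanishes off the union of [U] and [V]. *)
pose F := [set x | eps <= f x] `\` U.
have cF : closed F.
  by apply: closedI; [exact/usc_closed/continuous_usc|exact: open_closedC].
have [|k [ck k01 kV kF]] := urysohn_fun cK hK (open_closedC oV) cF.
  apply/seteqP; split=> // x [nVx [/= fx nUx]].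
  by move: fx; rewrite fUV ?leNgt ?eps0// => -[].
pose g x := f x * (1 + -1 * k x).
have cg : continuous g.
  by apply: continuous_RM => //; apply: continuous_RD => //; exact: continuous_RZ.
have g01 x : 0 <= g x <= 1.
  have /andP[f0 f1] := f01 x; have /andP[k0 k1] := k01 x; rewrite /g.
  by apply/andP; split; nra.
have cfk := continuous_RM cf ck.
have fkV : subordinate V (fun x => f x * k x).
  split=> // [x|x nVx]; last by rewrite kV ?mulr0.
  have /andP[f0 f1] := f01 x; have /andP[k0 k1] := k01 x.
  by apply/andP; split; nra.
have gU : subordinate U (cut eps g).
  split; [exact: cut_continuous|by move=> x; apply: cut01 => //; exact: ltW|].
  move=> x nUx; rewrite /cut max_r//; have [fx|fx] := leP eps (f x).
    by rewrite /g (kF x)//; lra.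
  by have /andP[f0 f1] := f01 x; have /andP[k0 k1] := k01 x; rewrite /g; nra.
have -> : phi f = phi (fun x => f x * k x) + phi g.
  by rewrite -phiD//; congr phi; apply/funext => x; rewrite /g; ring.
by have := phi_lam fkV; have := phi_lam gU; have := @phi_cut eps _ cg; lra.
Qed.

Let open_bigsetU n (U : nat -> set K) : (forall k, open (U k)) ->
  open (\big[setU/set0]_(k < n) U k).
Proof. by move=> oU; elim/big_ind: _ => //; [exact: open0|exact: openU]. Qed.

Let lam_bigsetU n (U : nat -> set K) : (forall k, open (U k)) ->
  lam (\big[setU/set0]_(k < n) U k) <= \sum_(k < n) lam (U k).
Proof.
move=> oU; elim: n => [|n ih].
  rewrite !big_ord0; apply: lam_le => f [cf _ f0].
  have -> : f = (fun _ => 0) by apply/funext => x; exact: f0.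
  by rewrite (phi_cst 0) mul0r.
rewrite !big_ord_recr/=; apply: le_trans (lam_setU _ _) _ => //.
  exact: open_bigsetU.
by rewrite lerD2r.
Qed.

(** The compact set [f >= eps] is covered by finitely many [U k], so [cut eps f] is subordinate to a
    finite union and finite subadditivity applies. *)
Let lam_bigcup (U : nat -> set K) : (forall k, open (U k)) ->
  ((lam (\bigcup_k U k))%:E <= \sum_(k <oo) (lam (U k))%:E)%E.
Proof.
move=> oU; set S := (\sum_(_ <oo) _)%E.
have Sge n : ((\sum_(k < n) lam (U k))%:E <= S)%E.
  rewrite -sumEFin -(big_mkord xpredT (fun k => (lam (U k))%:E)).
  by apply: nneseries_lim_ge => k _; rewrite lee_fin.
(* An infinite sum is trivial, and the empty partial sum excludes [-oo]. *)
case: S Sge => [s||] Sge; [|by rewrite leey|by have := Sge 0%N; rewrite big_ord0].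
rewrite lee_fin; apply: lam_le => f [cf f01 fU]; apply: le_eps => eps eps0.
pose P A := exists n, A `<=` \big[setU/set0]_(k < n) U k.
have cf_closed : closed [set x | eps <= f x] by exact/usc_closed/continuous_usc.
have cC : compact [set x | eps <= f x] by apply: subclosed_compact cf_closed cK _.
have [|A B AB [n Bn]|A B [n An] [m Bm]|x fx|n fn] :=
  @compact_induction _ [set x | eps <= f x] P cC.
- by exists 0%N.
- by exists n; exact: subset_trans Bn.
- exists (maxn n m); rewrite subUset; split.
    by apply: subset_trans An _; apply: subset_bigsetU; exact: leq_maxl.
  by apply: subset_trans Bm _; apply: subset_bigsetU; exact: leq_maxr.
- have [k _ Ukx] : (\bigcup_k U k) x.
    by apply: contrapT => /fU fx0; move: fx; rewrite /= fx0 leNgt eps0.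
  exists (U k); first by apply: open_nbhs_nbhs; split.
  by exists k.+1; rewrite big_ord_recr/=; exact: subsetUr.
- have : subordinate (\big[setU/set0]_(k < n) U k) (cut eps f).
    split; [exact: cut_continuous|by move=> x; apply: cut01 => //; exact: ltW|].
    move=> x nx; rewrite /cut max_r// subr_le0 leNgt; apply/negP => fx; apply: nx.
    by apply: fn; exact: ltW.
  move=> /phi_lam; have := @lam_bigsetU n _ oU; have := Sge n; rewrite lee_fin.
  by have := @phi_cut eps _ cf; lra.
Qed.

(** The real-valued form serves the arithmetic, [nu] the outer measure interface. The whole space is
    always a competitor, so the infimum is over a nonempty set. *)
Definition nur A : R := inf [set lam U | U in [set U | open U /\ A `<=` U]].
Definition nu A : \bar R := (nur A)%:E.

Let nur_le A U : open U -> A `<=` U -> nur A <= lam U.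
Proof.
move=> oU AU; apply: ge_inf; last by exists U.
by exists 0 => _ [V _ <-].
Qed.

Let nur_lb A c : (forall U, open U -> A `<=` U -> c <= lam U) -> c <= nur A.
Proof.
move=> h; apply: lb_le_inf; first by exists (lam setT), setT; split=> //; exact: openT.
by move=> _ [U [oU AU] <-]; exact: h.
Qed.

Let nur_adherent A eps : 0 < eps ->
  exists U, [/\ open U, A `<=` U & lam U <= nur A + eps].
Proof.
move=> eps0; apply: contrapT => h.
suff : nur A + eps <= nur A by lra.
apply: nur_lb => U oU AU; rewrite leNgt; apply/negP => lU; apply: h.
by exists U; split=> //; exact: ltW.
Qed.

Let nur_open U : open U -> nur U = lam U.
Proof.
move=> oU; apply/eqP; rewrite eq_le nur_le//=; apply: nur_lb => V oV; exact: le_lam.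
Qed.

Let nu_ge0 A : (0 <= nu A)%E.
Proof. by rewrite lee_fin; apply: nur_lb. Qed.

Let nu0 : nu set0 = 0%E.
Proof.
apply/eqP; rewrite eq_le nu_ge0 andbT lee_fin (nur_open open0).
by have := @lam_bigsetU 0 (fun _ => set0) (fun _ => open0); rewrite !big_ord0.
Qed.

Let le_nu : {homo nu : A B / A `<=` B >-> (A <= B)%E}.
Proof.
move=> A B AB; rewrite lee_fin; apply: nur_lb => U oU BU; apply: nur_le => //.
exact: subset_trans BU.
Qed.

Let nu_sigma_subadditive : sigma_subadditive nu.
Proof.
move=> F; apply/lee_addgt0Pr => eps eps0.
have [k|U HU] := @choice _ _ (fun k U => [/\ open U, F k `<=` U &
    lam U <= nur (F k) + eps / (2 ^ k.+1)%:R]).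
  by apply: nur_adherent; rewrite divr_gt0// ltr0n expn_gt0.
have oU k : open (U k) by have [] := HU k.
apply: le_trans (@epsilon_trick R (fun k => nu (F k)) eps xpredT
  (fun k => nu_ge0 (F k)) (ltW eps0)).
apply: (@le_trans _ _ (lam (\bigcup_k U k))%:E).
  rewrite lee_fin; apply: nur_le; first exact: bigcup_open.
  by apply: subset_bigcup => k _; have [] := HU k.
apply: le_trans (lam_bigcup oU) _; apply: lee_nneseries => k _.
  by rewrite lee_fin.
by have [_ _] := HU k; rewrite -lee_fin EFinD.
Qed.

HB.instance Definition _ := isOuterMeasure.Build R K nu nu0 nu_ge0 le_nu
  nu_sigma_subadditive.

(** Let [W] be an open set around [X], and let [f] be subordinate to the part of [W] in [U].
    Removing [f >= eps] from [W] leaves an open [V] that still contains the part of [X] off [U]. A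
    function [g] subordinate to [V] and [cut eps f] are never both nonzero, so their sum is
    subordinate to [W]. *)
Let open_caratheodory U : open U -> nu.-caratheodory U.
Proof.
move=> oU; apply: le_caratheodory_measurable => X.
rewrite -EFinD lee_fin; apply: nur_lb => W oW XW.
suff : nur (X `&` U) <= lam W - nur (X `&` ~` U) by lra.
apply: le_trans (@nur_le _ (W `&` U) _ _) _; [exact: openI|exact: setSI|].
apply: lam_le => f [cf f01 fWU]; apply: le_eps => eps eps0.
have cF : closed [set x | eps <= f x] by exact/usc_closed/continuous_usc.
pose V := W `\` [set x | eps <= f x].
have oV : open V by apply: openI => //; exact: closed_openC.
have XV : X `&` ~` U `<=` V.
  move=> x [Xx nUx]; split; first exact: XW.
  by rewrite /= fWU -?ltNge//; [apply/negP; rewrite -ltNge|case].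
have : lam V <= lam W - phi (cut eps f).
  apply: lam_le => g [cg g01 gV].
  suff /phi_lam : subordinate W (fun x => g x + cut eps f x).
    by rewrite phiD//; [lra|exact: cut_continuous].
  split; first by apply: continuous_RD => //; exact: cut_continuous.
  - move=> x; have /andP[g0 g1] := g01 x.
    have /andP[h0 h1] := cut01 (ltW eps0) (f01 x).
    have [fx|fx] := leP eps (f x); first by rewrite gV ?add0r ?h0// => -[_]; exact.
    by rewrite /cut max_r ?addr0 ?g0//; lra.
  - move=> x nWx; rewrite gV; last by case.
    by rewrite /cut fWU ?max_r; [lra|lra|case].
by have := nur_le oV XV; have := @phi_cut eps _ cf; lra.
Qed.

Let borel_caratheodory A : borel A -> nu.-caratheodory A.
Proof.
apply: smallest_sub; last exact: open_caratheodory.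
split.
- exact: caratheodory_measurable_set0.
- by move=> B mB; rewrite setTD; exact: caratheodory_measurable_setC.
- by move=> F mF; exact: caratheodory_measurable_bigcup.
Qed.

Let nu_semi_sigma_additive :
  semi_sigma_additive (nu : set (BorelK K) -> \bar R).
Proof.
move=> F mF tF mUF.
apply: (@caratheodory_measure_sigma_additive R K nu F) => //.
- by move=> k; apply: borel_caratheodory; exact: mF.
- exact: borel_caratheodory.
Qed.

HB.instance Definition _ := isMeasure.Build _ (BorelK K) R
  (nu : set (BorelK K) -> \bar R) nu0 nu_ge0 nu_semi_sigma_additive.

Definition riesz_measure : measureK K := (nu : set (BorelK K) -> \bar R).

(** Outer regularity is built into [nur]. For inner regularity, the compact set [f >= eps] has
    measure at least [phi (cut eps f)], since [cut eps f] is subordinate to every open set around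
    it. *)
Lemma riesz_measure_radon : radon riesz_measure.
Proof.
split; first by rewrite /riesz_measure /= /nu ltry.
- move=> A _; apply/eqP; rewrite eq_le; apply/andP; split.
    apply: le_ereal_inf_tmp => _ [U [_ AU] <-]; exact: le_nu.
  apply/lee_addgt0Pr => eps eps0.
  have [U [oU AU lU]] := nur_adherent A eps0.
  apply: ge_ereal_inf; exists (nu U); first by exists U.
  by rewrite /riesz_measure /= /nu -EFinD lee_fin nur_open.
- move=> U oU; apply/eqP; rewrite eq_le; apply/andP; split; last first.
    by apply: ge_ereal_sup => _ [C [_ CU] <-]; exact: le_nu.
  rewrite {1}/riesz_measure /= /nu nur_open//; set S := ereal_sup _.
  have Sge C : compact C -> C `<=` U -> ((nur C)%:E <= S)%E.
    by move=> cC CU; apply: ereal_sup_ubound; exists C.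
  case: S Sge => [s||] Sge; [|by rewrite leey|].
  + rewrite lee_fin; apply: lam_le => f [cf f01 fU]; apply: le_eps => eps eps0.
    have cF : closed [set x | eps <= f x] by exact/usc_closed/continuous_usc.
    have cC : compact [set x | eps <= f x] by apply: subclosed_compact cF cK _.
    have CU : [set x | eps <= f x] `<=` U.
      move=> x /= fx; apply: contrapT => /fU fx0.
      by move: fx; rewrite fx0 leNgt eps0.
    have := Sge _ cC CU; rewrite lee_fin => Cs.
    suff : phi (cut eps f) <= nur [set x | eps <= f x].
      by have := @phi_cut eps _ cf; lra.
    apply: nur_lb => V oV CV; apply: phi_lam.
    split; [exact: cut_continuous|by move=> x; apply: cut01 => //; exact: ltW|].
    move=> x nVx; rewrite /cut max_r// subr_le0 leNgt; apply/negP => fx; apply: nVx.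
    by apply: CV; exact: ltW.
  + have := Sge set0 compact0 (@sub0set _ _); by [].
Qed.

(** The term of index [k] is the length of the part of the interval from 0 to [t] that lies between
    [k] and [k + 1]. *)
Let clamp_sum n (t : R) : 0 <= t ->
  \sum_(k < n) Num.min (Num.max (t - k%:R) 0) 1 = Num.min t n%:R.
Proof.
move=> t0; elim: n => [|n ih]; first by rewrite big_ord0 min_r.
rewrite big_ord_recr/= ih -natr1.
by case: (leP t n%:R) => h1; case: (leP (t - n%:R) 0) => h2;
   case: (leP t (n%:R + 1)) => h3;
   do ?[rewrite min_l; [|lra]|rewrite min_r; [|lra]]; lra.
Qed.

Let T1 : (riesz_measure setT < +oo)%E.
Proof. by have [] := riesz_measure_radon. Qed.

Let I1 : intR riesz_measure (fun _ => 1) = phi (fun _ => 1).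
Proof. by rewrite intR1 /riesz_measure /= (nur_open openT) lamT. Qed.

(** After a shift making [f >= 0], [m f] is cut into slices [f_ k] subordinate to the open sets
    [f > k / m]. Each slice has [phi] at most the measure of its set, and the indicators of these
    sets sum to at most [m f + 1]. Dividing by [m] leaves an error of order [1 / m]. *)
Let phi_le_intR f : continuous f -> phi f <= intR riesz_measure f.
Proof.
move=> cf; have bf := continuous_bdd_measurable cK cf.
wlog f0 : f cf bf / forall x, 0 <= f x => [hw|].
  have [_ [c fc]] := bf; have cc := @continuous_Rcst K c.
  have := hw (fun x => f x + c) (continuous_RD cf cc).
  rewrite phiD// (intRD T1 bf (bdd_measurable_cst c)) (intRcst T1) I1 phi_cst lerD2r; apply.
    exact: bdd_measurable_D (bdd_measurable_cst c).
  by move=> x; have := fc x; rewrite ler_norml; lra.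
apply: le_eps => eps eps0; pose m := (Num.trunc (eps^-1)).+1.
have m0 : 0 < m%:R :> R by rewrite ltr0n.
have [_ [c fc]] := bf; pose n := (Num.trunc (m%:R * c)).+1.
pose f_ k x : R := Num.min (Num.max (m%:R * f x - k%:R) 0) 1.
have cf_ k : continuous (f_ k).
  apply: continuous_Rmin; last exact: continuous_Rcst.
  apply: continuous_Rmax; last exact: continuous_Rcst.
  by apply: continuous_RD; [exact: continuous_RZ|exact: continuous_Rcst].
pose U k := [set x | k%:R / m%:R < f x].
have oU k : open (U k).
  rewrite (_ : U k = [set x | - f x < - (k%:R / m%:R)]).
    exact/usc_open/continuous_usc/continuous_RN.
  by apply/seteqP; split=> x; rewrite /U /= ltrN2.
have sf_ k : subordinate (U k) (f_ k).
  split=> // [x|x]; first by rewrite /f_ le_min le_max lexx orbT ler01 ge_min lexx orbT.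
  move=> /negP; rewrite -leNgt ler_pdivlMr// => h.
  by rewrite /f_ max_r ?min_l ?ler01//; lra.
have bU k : borel (U k) by exact: borel_open.
have b1 k : bdd_measurable (\1_(U k)) by exact: bdd_measurable_indic.
have phiE : phi (fun x => m%:R * f x) = \sum_(k < n) phi (f_ k).
  have [_ <-] := @phi_sum n f_ cf_; congr phi; apply/funext => x.
  rewrite clamp_sum ?mulr_ge0// min_l//.
  apply: (@le_trans _ _ (m%:R * c)).
    by rewrite ler_pM2l//; apply: le_trans (fc x); exact: ler_norm.
  by apply: ltW; exact: Num.Theory.truncnS_gt.
have h1 : phi (fun x => m%:R * f x) <=
    intR riesz_measure (fun x => \sum_(k < n) \1_(U k) x).
  rewrite phiE (intRsum T1 n b1); apply: ler_sum => k _.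
  by rewrite intRindic// /riesz_measure /= nur_open//; exact: phi_lam.
have h2 : intR riesz_measure (fun x => \sum_(k < n) \1_(U k) x) <=
          intR riesz_measure (fun x => m%:R * f x + 1).
  apply: (le_intR T1); first exact: (bdd_measurable_sum n b1).
    by apply: bdd_measurable_D; [exact: bdd_measurable_Z|exact: bdd_measurable_cst].
  move=> x; apply: le_trans (@layer_sum_le n (m%:R * f x) _); last by rewrite mulr_ge0.
  apply: ler_sum => k _; rewrite indicE ler_nat.
  case: (boolP (x \in U k)) => // /set_mem; rewrite /U /= ltr_pdivrMr// mulrC.
  by move=> /ltW ->.
move: h2; rewrite (intRD T1 (bdd_measurable_Z _ bf) (bdd_measurable_cst _)) intRZ// I1 => h2.
have h3 : m%:R * phi f <= m%:R * intR riesz_measure f + phi (fun _ => 1).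
  by rewrite -phiZ//; apply: le_trans h1 h2.
rewrite -(ler_pM2l m0); apply: le_trans h3 _; rewrite mulrDr lerD2l mulrA.
have : 1 <= m%:R * eps.
  by rewrite -ler_pdivrMr// mul1r; apply: ltW; exact: Num.Theory.truncnS_gt.
by move=> h; have := ler_wpM2r m1_ge0 h; rewrite mul1r.
Qed.

(** The inequality already obtained, applied to [- f], is the reverse one. *)
Lemma intR_riesz_measure f : continuous f -> intR riesz_measure f = phi f.
Proof.
move=> cf; apply/eqP; rewrite eq_le phi_le_intR// andbT.
have cN := continuous_RZ (t := -1) cf.
have := phi_le_intR cN; rewrite phiZ// intRZ//; first lra.
exact: continuous_bdd_measurable.
Qed.

End Riesz.

(** * Minimal measures *)

Section Integral.
Context {K : ptopologicalType} (cK : compact [set: K]) (mu : measureK K)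
  (mufin : (mu setT < +oo)%E).

Lemma integ_funeposneg (f : K -> R) : integ mu f =
  (integ mu (fun x => Num.max (f x) 0)%R - integ mu (fun x => Num.max (- f x) 0)%R)%E.
Proof.
rewrite /integ integralE; congr (_ - _)%E; apply: eq_integral => x _.
  by rewrite funeposE EFin_max.
by rewrite funenegE EFin_max EFinN.
Qed.

Lemma usc_max_bdd_measurable (f : K -> R) a : upper_semicontinuous f ->
  bdd_measurable (fun x => Num.max (f x) a).
Proof.
move=> uf; split.
  by apply: measurable_maxr; [exact: usc_measurable|exact: measurable_cst].
have [c fc] := usc_ubound cK uf; exists (`|c| + `|a|) => x.
have := fc x; have := ler_norm c; have := ler_norm a; have := ler_norm (- a).
have := normr_ge0 a; have := normr_ge0 c; rewrite normrN.
by case: (leP (f x) a) => *; rewrite ler_norml; apply/andP; split; lra.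
Qed.

(** Since [f] may be unbounded below, positive and negative parts are compared separately, as
    integrals of nonnegative functions. *)
Lemma le_integ_usc (f g : K -> R) : upper_semicontinuous f -> continuous g ->
  (forall x, f x <= g x) -> (integ mu f <= integ mu g)%E.
Proof.
move=> uf cg fg; have ug := continuous_usc cg.
have uN := continuous_usc (continuous_RN cg).
have mfN : measurable_fun [set: BorelK K]
    ((fun x => Num.max (- f x) 0) : BorelK K -> measurableTypeR R).
  apply: measurable_maxr; last exact: measurable_cst.
  by apply: measurable_funN; exact: usc_measurable.
have mono (u v : K -> R) : (forall x, 0 <= u x) -> (forall x, u x <= v x) ->
    measurable_fun [set: BorelK K] (u : BorelK K -> measurableTypeR R) ->
    measurable_fun [set: BorelK K] (v : BorelK K -> measurableTypeR R) ->
    (integ mu u <= integ mu v)%E.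
  move=> u0 uv mu_ mv; rewrite /integ.
  apply: (@ge0_le_integral _ (BorelK K) R mu setT measurableT).
  - by move=> x _; rewrite lee_fin.
  - exact/measurable_EFinP.
  - exact/measurable_EFinP.
  - by move=> x _; rewrite lee_fin.
rewrite (integ_funeposneg f) (integ_funeposneg g); apply: leeB; apply: mono => //.
- by move=> x; rewrite le_max lexx orbT.
- by move=> x; rewrite ge_max !le_max lexx fg orbT.
- exact: (proj1 (usc_max_bdd_measurable 0 uf)).
- exact: (proj1 (usc_max_bdd_measurable 0 ug)).
- by move=> x; rewrite le_max lexx orbT.
- by move=> x; rewrite ge_max !le_max lexx lerN2 fg orbT.
- exact: (proj1 (usc_max_bdd_measurable 0 uN)).
Qed.

(** Truncation at [- n] keeps the positive part and replaces the negative part [fm] by its minimum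
    with [n]; monotone convergence applies to the latter. *)
Lemma le_integ_truncations (f : K -> R) c : upper_semicontinuous f ->
  (forall n : nat, (c <= integ mu (fun x => Num.max (f x) (- n%:R))%R)%E) ->
  (c <= integ mu f)%E.
Proof.
move=> uf hc; have bn n := usc_max_bdd_measurable (- n%:R) uf.
pose fp x := Num.max (f x) 0; pose fm x := Num.max (- f x) 0.
have bp : bdd_measurable fp by exact: usc_max_bdd_measurable.
have mm : measurable_fun [set: BorelK K] (fm : BorelK K -> measurableTypeR R).
  apply: measurable_maxr; last exact: measurable_cst.
  by apply: measurable_funN; exact: usc_measurable.
pose g n x := Num.min (fm x) n%:R.
have bg n : bdd_measurable (g n).
  split; first by apply: measurable_minr => //; exact: measurable_cst.
  exists n%:R => x; rewrite ger0_norm ?ge_min ?lexx ?orbT//.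
  by rewrite le_min ler0n andbT le_max lexx orbT.
have fE n : integ mu (fun x => Num.max (f x) (- n%:R)) = (intR mu fp - intR mu (g n))%:E.
  rewrite integE// (_ : (fun x => _) = fp \+ (fun x => -1 * g n x)).
    rewrite (intRD mufin bp (bdd_measurable_Z _ (bg n))) (intRZ mufin _ (bg n)).
    by congr EFin; lra.
  apply/funext => x /=; rewrite /fp /g /fm; have n0 := ler0n R n.
  case: (leP (f x) (- n%:R)) => h1; case: (leP (f x) 0) => h2;
  case: (leP (- f x) 0) => h3; case: leP => h4; lra.
rewrite (integ_funeposneg f) (integE mufin bp).
have {}hc n : (c <= (intR mu fp - intR mu (g n))%:E)%E by rewrite -fE.
case: c hc => [c| |] hc; [|by have := hc 0%N|by rewrite leNye].
suff : (integ mu fm <= (intR mu fp - c)%:E)%E.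
  rewrite -leeN2 -EFinN => h.
  have := leeD2l (intR mu fp)%:E h; rewrite -EFinD.
  by apply: le_trans; rewrite lee_fin; lra.
have lim x : limn (fun n => (g n x)%:E) = (fm x)%:E.
  (* The sequence is constant once [n] exceeds [fm x]. *)
  apply/cvg_lim => //; apply: cvg_near_cst; exists (Num.trunc (fm x)).+1 => // n /= hn.
  rewrite /g min_l//; apply: ltW; apply: lt_le_trans (Num.Theory.truncnS_gt _) _.
  by rewrite ler_nat.
have gcvg := @cvg_monotone_convergence _ (BorelK K) R mu setT measurableT
   (fun n x => (g n x)%:E).
have {}gcvg := gcvg (fun n => proj2 (measurable_EFinP _ _) (proj1 (bg n))).
have {}gcvg : (integ mu (g n) @[n --> \oo] --> integ mu fm)%E.
  rewrite {2}/integ; under eq_integral do rewrite -lim.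
  apply: gcvg => [n x _|x _ n m nm].
    by rewrite lee_fin le_min ler0n andbT le_max lexx orbT.
  rewrite lee_fin /g le_min !ge_min lexx/=.
  by rewrite ler_nat nm orbT.
rewrite -(cvg_lim _ gcvg)//; apply: lime_le.
  by apply/cvg_ex; exists (integ mu fm).
by apply: nearW => n; have := hc n; rewrite integE// !lee_fin; lra.
Qed.
End Integral.

Section Main.
Context {M : Type} {d : M -> M -> R} (hmet : is_metric d).
Context {K : ptopologicalType} {e : Mt M -> K} (cK : compact [set: K])
  (hK : hausdorff_space K).
Implicit Types (f g h : K -> R).

Definition sim_invariant f := forall z w, Gsim d e z w -> f z = f w.

Lemma inG_bdd_measurable g : inG d e g -> bdd_measurable g.
Proof. by move=> [cg _]; exact: continuous_bdd_measurable. Qed.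

Lemma integ_le_Ginf (mu : measureK K) f : upper_semicontinuous f ->
  (integ mu f <= Ginf d e mu f)%E.
Proof.
move=> uf; apply: le_ereal_inf_tmp => _ [g [gG fg] <-].
by apply: le_integ_usc => //; case: gG.
Qed.

Lemma Ginf_le (mu : measureK K) f g : inG d e g -> (forall x, f x <= g x) ->
  (Ginf d e mu f <= integ mu g)%E.
Proof. by move=> gG fg; apply: ge_ereal_inf; exists (integ mu g) => //; exists g. Qed.

Lemma le_Ginf (mu : measureK K) f h : (forall x, f x <= h x) ->
  (Ginf d e mu f <= Ginf d e mu h)%E.
Proof.
move=> fh; apply: ereal_inf_le_tmp => _ [g [gG hg] <-]; exists g => //; split=> // x.
exact: le_trans (hg x).
Qed.

Section Radon.
Variables (mu : measureK K) (rmu : radon mu).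
Let mufin : (mu setT < +oo)%E. Proof. by case: rmu. Qed.

(** The real-valued counterpart of [Ginf], as Hahn-Banach requires. For continuous [f] a large
    constant is a competitor and [intR mu f] a lower bound, so the infimum is a genuine one. *)
Definition upper f : R :=
  inf [set intR mu g | g in [set g | inG d e g /\ forall x, f x <= g x]].

Let upper_lb f : continuous f ->
  lbound [set intR mu g | g in [set g | inG d e g /\ forall x, f x <= g x]] (intR mu f).
Proof.
move=> cf _ [g [gG fg] <-]; apply: (le_intR mufin) => //; last exact: inG_bdd_measurable.
exact: continuous_bdd_measurable.
Qed.

Let upper_le f g : continuous f -> inG d e g -> (forall x, f x <= g x) ->
  upper f <= intR mu g.
Proof.
move=> cf gG fg; apply: ge_inf; last by exists g.
by exists (intR mu f); exact: upper_lb.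
Qed.

Let le_upper f c : continuous f ->
  (forall g, inG d e g -> (forall x, f x <= g x) -> c <= intR mu g) -> c <= upper f.
Proof.
move=> cf h; apply: lb_le_inf; last by move=> _ [g [gG fg] <-]; exact: h.
have [c' fc'] := continuous_bounded cK cf.
exists (intR mu (fun _ => Num.max c' 0)), (fun _ => Num.max c' 0) => //; split.
  by apply: inG_cst => //; rewrite le_max lexx orbT.
move=> x; rewrite le_max; apply/orP; left; apply: le_trans (fc' x).
exact: ler_norm.
Qed.

(** The ambient vector space is that of all functions; [upper] is sublinear on this subspace. *)
Let continuousK : set (K -> R^o) := fun f => continuous (f : K -> R).

Let upper_sublinear : @sublinear_on (K -> R^o) continuousK upper.
Proof.
split=> [f g cf cg|t f t0 cf].
- have cfg := continuous_RD cf cg.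
  suff : upper (f + g) - upper f <= upper g by lra.
  apply: le_upper => // g' g'G gg'.
  suff : upper (f + g) - intR mu g' <= upper f by lra.
  apply: le_upper => // f' f'G ff'.
  suff : upper (f + g) <= intR mu f' + intR mu g' by lra.
  rewrite -intRD//; try exact: inG_bdd_measurable.
  by apply: upper_le => //; [exact: inG_D|move=> x; exact: lerD].
- have ctf := continuous_RZ (t := t) cf.
  suff : upper (t *: f) / t <= upper f by rewrite ler_pdivrMr// mulrC.
  apply: le_upper => // g gG fg; rewrite ler_pdivrMr// mulrC -intRZ//.
    by apply: upper_le => //; [apply: inG_Z => //; exact: ltW|move=> x; rewrite ler_pM2l].
  exact: inG_bdd_measurable.
Qed.

Lemma minimal_continuous f : Gminimal d e mu -> continuous f -> sim_invariant f ->
  integ mu f = Ginf d e mu f.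
Proof.
move=> mumin cf sf; have bf := continuous_bdd_measurable cK cf.
have SD (x y : K -> R^o) : continuousK x -> continuousK y -> continuousK (x + y).
  exact: continuous_RD.
have SZ (t : R) (x : K -> R^o) : continuousK x -> continuousK (t *: x).
  exact: continuous_RZ.
have S0 : continuousK 0 by exact: continuous_Rcst.
have [phi [phiD phiZ phip phif]] := hahn_banach SD SZ S0 upper_sublinear cf.
have phi_ge0 g : continuous g -> (forall x, 0 <= g x) -> 0 <= phi g.
  (* The constant 0 belongs to the cone and lies above [- g], so [upper] is at most 0 there. *)
  move=> cg g0; have : phi (-1 *: (g : K -> R^o)) <= 0.
    apply: le_trans (phip _ (SZ _ _ cg)) _.
    apply: le_trans (upper_le (g := fun _ => 0) (SZ _ _ cg) _ _) _.
    - exact: inG_cst.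
    - move=> x; have gx := g0 x; suff : -1 * g x <= 0 by [].
      lra.
    - by rewrite (intRcst mufin) mul0r.
  by rewrite phiZ//; lra.
pose nu := riesz_measure cK hK phiD phiZ phi_ge0.
have rnu : radon nu by exact: riesz_measure_radon.
have nufin : (nu setT < +oo)%E by case: rnu.
have nuE g : continuous g -> intR nu g = phi g.
  by move=> cg; exact: intR_riesz_measure.
have nu_mu : Gle d e nu mu.
  move=> g gG; have bg := inG_bdd_measurable gG; rewrite !integE// lee_fin nuE; last by case: gG.
  by apply: le_trans (phip _ _) _; [case: gG|apply: upper_le => //; case: gG].
have nuL h : inL d e h -> intR nu h = intR mu h.
  have nuG g : inG d e g -> intR nu g = intR mu g.
    move=> gG; have bg := inG_bdd_measurable gG; apply/eqP; rewrite eq_le.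
    have := nu_mu g gG; have := mumin nu rnu nu_mu g gG.
    by rewrite !integE// !lee_fin => -> ->.
  move=> [u [v [uG vG ->]]]; have [bu bv] := (inG_bdd_measurable uG, inG_bdd_measurable vG).
  rewrite (_ : (fun x => _) = u \+ (fun x => -1 * v x)); last first.
    by apply/funext => x /=; ring.
  have bvN := bdd_measurable_Z (-1) bv.
  by rewrite !intRD// !intRZ// !nuG.
apply/eqP; rewrite eq_le integ_le_Ginf; last exact: continuous_usc.
rewrite integE//.
apply: (@le_trans _ _ (upper f)%:E).
  have hG g : inG d e g -> (forall x, f x <= g x) ->
      (Ginf d e mu f <= (intR mu g)%:E)%E.
    by move=> gG fg; rewrite -integE//; [exact: Ginf_le|exact: inG_bdd_measurable].
  (* The case [+oo] is excluded by a constant of the cone above [f]. *)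
  case: (Ginf d e mu f) hG => [r| |] hG; last by rewrite leNye.
    by rewrite lee_fin; apply: le_upper => // g gG fg; rewrite -lee_fin; exact: hG.
  have [c fc] := (proj2 bf).
  have cG : inG d e (fun _ => Num.max c 0).
    by apply: inG_cst => //; rewrite le_max lexx orbT.
  suff fM : forall x, f x <= Num.max c 0 by have := hG _ cG fM; rewrite leye_eq.
  move=> x; rewrite le_max; apply/orP; left.
  by apply: le_trans (fc x); exact: ler_norm.
(* The approximation is made in [mu]-mean and then moved to [nu]: the [nu]-integral of [f] is at
   most that of [h], which equals the [mu]-integral of [h], itself at most that of [f] plus
   [eps]. *)
rewrite lee_fin -phif -nuE//; apply/ler_addgt0Pr => eps eps0.
have [h [hL fh Ih]] := inL_approx_usc hmet cK rmu (continuous_usc cf) sf bf eps0.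
apply: le_trans Ih; rewrite -nuL//.
exact: (le_intR nufin bf (inL_bdd_measurable cK hL) fh).
Qed.

(** Truncating from below makes [f] bounded, so some [h] in the lattice lies above it with nearly
    the same integral. The continuous case for [h] bounds [Ginf] of [f] by the integral of each
    truncation. *)
Lemma continuous_to_usc :
  (forall f, continuous f -> sim_invariant f -> integ mu f = Ginf d e mu f) ->
  forall f, upper_semicontinuous f -> sim_invariant f -> integ mu f = Ginf d e mu f.
Proof.
move=> hc f uf sf; apply/eqP; rewrite eq_le integ_le_Ginf//=.
apply: (le_integ_truncations cK mufin uf) => n.
have bn := usc_max_bdd_measurable cK (- n%:R) uf.
have un : upper_semicontinuous (fun x => Num.max (f x) (- n%:R)).
  move=> x c; rewrite gt_max => /andP[fc nc]; apply: filterS (uf x c fc) => y fy.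
  by rewrite gt_max fy.
have sn : sim_invariant (fun x => Num.max (f x) (- n%:R)).
  by move=> z w /sf ->.
rewrite integE//; apply/lee_addgt0Pr => eps eps0.
have [h [hL fh Ih]] := inL_approx_usc hmet cK rmu un sn bn eps0.
apply: (@le_trans _ _ (intR mu h)%:E); last by rewrite -EFinD lee_fin.
rewrite -integE//; last exact: (inL_bdd_measurable cK hL).
rewrite hc; [|exact: (inL_continuous hL)|by move=> z w; exact: inL_sim].
by apply: le_Ginf => x; apply: le_trans (fh x); rewrite le_max lexx.
Qed.

(** For upper semicontinuous [f], the least function above [f] that is constant on the fibres of the
    quotient map. *)
Definition fibre_sup f z : R := sup [set f w | w in [set w | Gsim d e z w]].

Lemma fibre_sup_ub f z w : upper_semicontinuous f -> Gsim d e z w ->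
  f w <= fibre_sup f z.
Proof.
move=> uf zw; have [c fc] := usc_ubound cK uf.
by apply: ub_le_sup; [exists c => _ [y _ <-]|exists w].
Qed.

Lemma fibre_sup_le f z c : (forall w, Gsim d e z w -> f w <= c) -> fibre_sup f z <= c.
Proof.
move=> fc; apply: ge_sup; last by move=> _ [w zw <-]; exact: fc.
by exists (f z), z => //; exact: Gsim_refl.
Qed.

Lemma fibre_sup_invariant f : sim_invariant (fibre_sup f).
Proof.
move=> z w zw; congr sup; congr (_ @` _); apply/seteqP; split=> y /=.
  by apply: Gsim_trans; rewrite Gsim_sym.
exact: Gsim_trans.
Qed.

(** The fibre of [z] misses the closed set [f >= c'], and some [h] in the lattice with [h z = 0] is
    at least 1 on that set. Near [z] one has [h < 1], and as [h] is constant on fibres, the whole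
    fibre of a nearby point misses the set too. *)
Lemma fibre_sup_usc f : upper_semicontinuous f -> upper_semicontinuous (fibre_sup f).
Proof.
(* A bound on all values over a fibre passes to the supremum only as a weak inequality; the midpoint
   restores strictness. *)
move=> uf z c zc; pose c' := (fibre_sup f z + c) / 2.
have [zc' c'c] : fibre_sup f z < c' /\ c' < c by rewrite /c'; split; lra.
have [w fw|h [hL h0 hz hF]] := inL_separation hmet (e := e) cK (z := z) (usc_closed (c := c') uf).
  by apply/negP => zw; have := le_lt_trans (fibre_sup_ub uf zw) zc'; rewrite ltNge fw.
have hz1 : h z < 1 by rewrite hz; lra.
apply: filterS (cvgr_lt (h z) (inL_continuous hL (x:=z)) 1 hz1) => y hy.
apply: le_lt_trans c'c; apply: fibre_sup_le => w yw.
rewrite leNgt; apply/negP => /ltW/hF; rewrite -(inL_sim hL yw).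
by rewrite leNgt hy.
Qed.

Lemma borel_preimage_qG (A : set (MtG d e)) : borel A -> borel (qG d e @^-1` A).
Proof.
pose S := [set B : set (MtG d e) | borel (qG d e @^-1` B)].
have : sigma_algebra setT S.
  split; rewrite /S /=.
  - by rewrite preimage_set0; exact: sigma_algebra0.
  - move=> B bB; rewrite setTD preimage_setC; exact: (@measurableC _ (BorelK K)).
  - move=> F bF; rewrite preimage_bigcup; exact: (@bigcupT_measurable _ (BorelK K)).
(* Open in the quotient topology means, by definition, having an open preimage. *)
move=> sS; apply: (smallest_sub sS) => U oU; exact: borel_open.
Qed.

(** [f] and [fibre_sup f] agree over [A], so their integrals coincide. They also have the same
    majorants in the cone, whose elements are constant on fibres. *)
Lemma usc_to_local :
  (forall f, upper_semicontinuous f -> sim_invariant f -> integ mu f = Ginf d e mu f) ->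
  forall A : set (MtG d e), borel A -> mu (~` (qG d e @^-1` A)) = 0%E ->
  forall f, upper_semicontinuous f ->
    (forall z w, A (qG d e z) -> Gsim d e z w -> f z = f w) ->
    integ mu f = Ginf d e mu f.
Proof.
move=> hs A bA muA f uf sf; have us := fibre_sup_usc uf.
have f_le x : f x <= fibre_sup f x by apply: fibre_sup_ub => //; exact: Gsim_refl.
transitivity (integ mu (fibre_sup f)).
  apply: ae_eq_integral => //.
  - by apply/measurable_EFinP; exact: usc_measurable.
  - by apply/measurable_EFinP; exact: usc_measurable.
  - exists (~` (qG d e @^-1` A)); split=> //.
      by apply: (@measurableC _ (BorelK K)); exact: borel_preimage_qG.
    move=> x /= nE Ax; apply: nE => _; congr EFin.
    apply/eqP; rewrite eq_le f_le/=; apply: fibre_sup_le => w xw.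
    by rewrite (sf x w).
rewrite hs//; last exact: fibre_sup_invariant.
apply/eqP; rewrite eq_le; apply/andP; split; last exact: le_Ginf.
apply: le_ereal_inf_tmp => _ [g [gG fg] <-]; apply: Ginf_le => // x.
by apply: fibre_sup_le => w /asboolP/(_ g gG) ->.
Qed.

(** If [nu] precedes [mu] and [h] in the cone lies above [- g], then the [nu]-integral of [- g] is
    at most the [mu]-integral of [h]. The infimum over [h] is the [mu]-integral of [- g]. *)
Lemma continuous_minimal :
  (forall f, continuous f -> sim_invariant f -> integ mu f = Ginf d e mu f) ->
  Gminimal d e mu.
Proof.
move=> hc nu [nufin _ _] nu_mu g gG; have [cg _] := gG; have bg := inG_bdd_measurable gG.
have cN := continuous_RZ (t := -1) cg; have bN := bdd_measurable_Z (-1) bg.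
have : (integ nu (fun x => -1 * g x)%R <= integ mu (fun x => -1 * g x)%R)%E.
  rewrite (hc _ cN); last by move=> z w /asboolP/(_ g gG) ->.
  apply: le_ereal_inf_tmp => _ [h [hG gh] <-]; apply: le_trans (nu_mu h hG).
  by apply: (le_integ_usc cK nu (continuous_usc cN)) => //; case: hG.
by rewrite !integE// !lee_fin !intRZ//; lra.
Qed.
End Radon.
End Main.

Theorem theorem4p1 (M : Type) (d : M -> M -> R) (x0 : M)
    (hmet : is_metric d) (hcompl : metric_complete d)
    (h3 : exists x y z : M, [/\ x <> y, y <> z & x <> z])
    (K : ptopologicalType) (e : Mt M -> K) (hK : is_stone_cech d e)
    (mu : measureK K) (hmu : radon mu) :
  [<-> Gminimal d e mu;
       forall f : K -> R, continuous f ->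
         (forall z w : K, Gsim d e z w -> f z = f w) ->
         integ mu f = Ginf d e mu f;
       forall f : K -> R, upper_semicontinuous f ->
         (forall z w : K, Gsim d e z w -> f z = f w) ->
         integ mu f = Ginf d e mu f;
       forall A : set (MtG d e), borel A ->
         mu (~` (qG d e @^-1` A)) = 0%E ->
         forall f : K -> R, upper_semicontinuous f ->
           (forall z w : K, A (qG d e z) -> Gsim d e z w -> f z = f w) ->
           integ mu f = Ginf d e mu f].
Proof.
have [cK hsK _ _ _] := hK; tfae.
- by move=> mumin f; exact: minimal_continuous.
- exact: continuous_to_usc.
- exact: usc_to_local.
- move=> hA; apply: continuous_minimal => // f cf sf.
  (* Over the whole quotient the fibre condition is the global one and the exceptional set is
     empty. *)
  apply: (hA setT) => //; first exact: (@measurableT _ (BorelK (MtG d e))).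
  + by rewrite preimage_setT setCT measure0.
  + exact: continuous_usc.
  + by move=> z w _; exact: sf.
Qed.
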